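(* Let $\beta\in[0,1)$, $\gamma=1-\beta$, $k\le n$, and $f\le\beta k$. In the synchronous Data Retrieval model with $k$ peers, an $n$-bit source and at most $f$ crash faults, there is a deterministic protocol that solves Download with $$\mathcal Q=O\!\left(\frac{n}{\gamma k}\right),\qquad \mathcal T=O(nf),\qquad \mathcal M=O(k^2\cdot f n).$$
   Context: Data Retrieval (DR) model. There are $k$ peers with unique IDs forming a complete network, and a trusted read-only external source storing an array $X=(b_1,\dots,b_n)\in\{0,1\}^n$, with $n\ge k$. A query $\mathrm{Query}(i)$ by a peer to the source returns $b_i$. Synchronous rounds: each round has three sub-rounds: (1) each peer sends any number (between $0$ and $n$) of queries to the source; (2) the source answers all of them; (3) peers exchange messages, delivered within the round. A peer may send a different message to each other peer. Every message has size $O(\log n)$ bits. Local computation is free and instantaneous. Crash faults: a crashed peer stops its execution permanently at an arbitrary time chosen by an all-knowing adversary, possibly in the middle of a sub-round (after sending some but not all of its messages). At most $f$ peers crash; the others are nonfaulty. The adversary also chooses $X$. Download problem: every nonfaulty peer must output an array equal to $X$. Complexity measures: $\mathcal Q$ = maximum number of bits queried by any nonfaulty peer; $\mathcal T$ = number of rounds until termination; $\mathcal M$ = total number of messages sent by nonfaulty peers.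
   Formalization: In the bounds on T and M the factor f is read as max(f,1), since for f = 0 the literal bounds O(nf) and O(k^2 f n) would be 0, and no protocol can download X in zero rounds; for f ≥ 1 the bounds are as stated. *)

(* Defs.v *)
From mathcomp Require Import all_boot.

Set Implicit Arguments.
Unset Strict Implicit.
Unset Printing Implicit Defensive.

(* The synchronous Data Retrieval model with crash faults.  Peers are the
   elements of 'I_k and the source array is X : n.-tuple bool. *)

(* A message is a bit string of length at most w. *)
Definition message (w : nat) := w.-bseq bool.

(* The result of the first two sub-rounds: Some b at the queried positions. *)
Definition answers (n : nat) := {ffun 'I_n -> option bool}.

(* [inbox q] is the message received from q in the current round, if any. *)
Definition inbox (k w : nat) := {ffun 'I_k -> option (message w)}.

(* A deterministic protocol for k peers, an n-bit source and w-bit messages.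
   The state is that of one peer; it knows its ID through [init].  The messages
   of a round may depend on the answers of that round, but not on the messages
   received in it.  A peer terminates when [output] becomes defined. *)
Record protocol (k n w : nat) := Protocol {
  state : Type;
  init : 'I_k -> state;
  query : state -> {set 'I_n};
  send : state -> answers n -> 'I_k -> option (message w);
  update : state -> answers n -> inbox k w -> state;
  output : state -> option (n.-tuple bool)
}.

(* A crash in round [crash_round]: the peer takes full part in all earlier
   rounds and in none of the later ones, and in the round of the crash exactly
   its messages to the peers in [crash_reach] leave it.  A crash in one of the
   first two sub-rounds amounts to [crash_reach = set0], whatever part of the
   queries was made: the queries of a faulty peer are not counted, and its
   state is not used any more. *)
Record crash (k : nat) := Crash {
  crash_round : nat;
  crash_reach : {set 'I_k}
}.

(* The choices of the adversary, apart from X.  Since protocols are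
   deterministic, an adaptive, all-knowing adversary is no stronger than a
   universal quantification over these. *)
Definition adversary (k : nat) := 'I_k -> option (crash k).

Definition faulty (k : nat) (adv : adversary k) : {set 'I_k} :=
  [set p | isSome (adv p)].

(* p is still running at the end of round r. *)
Definition survives (k : nat) (adv : adversary k) (r : nat) (p : 'I_k) : bool :=
  if adv p is Some c then r < crash_round c else true.

(* In round r, p has not crashed before sending its message to q. *)
Definition may_send (k : nat) (adv : adversary k) (r : nat) (p q : 'I_k) : bool :=
  if adv p is Some c then
    (r < crash_round c) || ((r == crash_round c) && (q \in crash_reach c))
  else true.

Section Execution.
Variables (k n w : nat) (P : protocol k n w).
Variables (X : n.-tuple bool) (adv : adversary k).

Definition config := 'I_k -> state P.

Definition halted (s : state P) : bool := isSome (output s).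

(* The queries of a state in one round; a terminated peer makes none. *)
Definition queried (s : state P) : {set 'I_n} :=
  if halted s then set0 else query s.

Definition answer (s : state P) : answers n :=
  [ffun i => if i \in queried s then Some (tnth X i) else None].

(* The message from p to q in round r; only messages to other peers exist, and
   a terminated peer sends none. *)
Definition sent (r : nat) (C : config) (p q : 'I_k) : option (message w) :=
  if [&& p != q, ~~ halted (C p) & may_send adv r p q]
  then send (C p) (answer (C p)) q else None.

Definition step (r : nat) (C : config) : config := fun p =>
  if halted (C p) || ~~ survives adv r p then C p
  else update (C p) (answer (C p)) [ffun q => sent r C q p].

(* The configuration after t rounds, which are numbered from 0. *)
Fixpoint run (t : nat) : config :=
  if t is r.+1 then step r (run r) else @init k n w P.

(* Every nonfaulty peer has terminated after t rounds, with output X. *)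
Definition downloaded (t : nat) : Prop :=
  forall p, p \notin faulty adv -> output (run t p) = Some X.

Definition queries_made (t : nat) (p : 'I_k) : nat :=
  \sum_(r < t) #|queried (run r p)|.

Definition messages_sent (t : nat) : nat :=
  \sum_(r < t) \sum_(p in ~: faulty adv)
    #|[set q : 'I_k | isSome (sent r (run r) p q)]|.

End Execution.

(* Main.v *)
Require Import Defs.
From mathcomp Require Import all_boot all_order all_algebra zify.
Import Order.TTheory GRing.Theory Num.Theory.
Local Open Scope ring_scope.

(* The bits are downloaded one after another, each in a phase of f + 1 rounds
   coordinated by f + 1 consecutive peers in cyclic order.  A coordinator that
   holds no claim yet queries the bit; it then broadcasts its claim, the bit
   together with the offset of the peer that queried it, and everybody adopts
   the last claim heard.  One of the coordinators is nonfaulty, so at the end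
   of the phase all live peers hold the same claim, and the next phase starts
   just after the peer named in it.  A phase thus moves the starting point past
   at most one nonfaulty peer, so that it passes each of the at least k - f
   nonfaulty peers about n / (k - f) times, and a nonfaulty peer queries only
   when it is passed. *)

Section RotatingCoordinator.
Local Open Scope nat_scope.
Variables k n f w : nat.
Local Notation peer_id := 'I_k.+1.

(** * Coding of claims as messages *)

Definition encode (v : bool * nat) : message w :=
  nth [bseq] (enum {: w.-bseq bool}) (v.2.*2 + v.1).

Definition decode (m : message w) : bool * nat :=
  let i := index m (enum {: w.-bseq bool}) in (odd i, i./2).

Lemma leq_card_message : 2 ^ w <= #|{: w.-bseq bool}|.
Proof.
rewrite -card_bool -card_tuple.
apply: (@leq_card _ _ (@bseq_of_tuple w bool)) => s t /(congr1 val) /= st.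
exact: val_inj.
Qed.

(** The bound keeps the index 2d + b inside the enumeration, so the default of [nth] is not
    reached. *)
Lemma encodeK v : v.2.+1.*2 <= 2 ^ w -> decode (encode v) = v.
Proof.
case: v => b d /= dw; have sz : d.*2 + b < size (enum {: w.-bseq bool}).
  rewrite -cardE; apply: leq_trans leq_card_message; lia.
rewrite /decode /encode index_uniq ?enum_uniq //=; congr pair; last by lia.
by rewrite oddD odd_double oddb.
Qed.

(** * The protocol *)

Record peer := Peer {
  self : peer_id;
  known : seq bool;
  start : nat; (* not reduced modulo the number of peers *)
  offset : nat; (* the round within the phase *)
  held : option (bool * nat)
}.

Definition coordinator (s : peer) : peer_id := inZp (start s + offset s).

Definition claim (s : peer) (a : answers n) : bool * nat :=
  if held s is Some v then v
  else (odflt false (obind a (insub (size (known s)))), offset s).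

Definition needed (s : peer) : {set 'I_n} :=
  [set i : 'I_n | [&& self s == coordinator s, held s == None
                    & val i == size (known s)]].

Definition broadcast (s : peer) (a : answers n) (_ : peer_id) :
    option (message w) :=
  if self s == coordinator s then Some (encode (claim s a)) else None.

(** No peer sends to itself, so a coordinator records its own claim directly. *)
Definition learn (s : peer) (a : answers n) (ib : inbox k.+1 w) :=
  if self s == coordinator s then Some (claim s a)
  else if ib (coordinator s) is Some m then Some (decode m) else held s.

Definition end_phase (s : peer) : peer :=
  if offset s <= f then s else
  let v := odflt (false, 0) (held s) in
  Peer (self s) (rcons (known s) v.1) (start s + v.2).+1 0 None.

Definition advance (s : peer) (a : answers n) (ib : inbox k.+1 w) : peer :=
  end_phase (Peer (self s) (known s) (start s) (offset s).+1 (learn s a ib)).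

Definition rotating : protocol k.+1 n w :=
  Protocol (fun p => Peer p [::] 0 0 None) needed broadcast advance
    (fun s => insub (known s)).

(** * Passes of the starting point over a peer *)

Definition visits (p : peer_id) (s : nat) : nat :=
  \sum_(x < s) (inZp x == p).

Lemma visitsS p s : visits p s.+1 = visits p s + (inZp s == p).
Proof. exact: big_ord_recr. Qed.

Lemma visits_mono p s t : s <= t -> visits p s <= visits p t.
Proof.
move/subnK <-; elim: (t - s) => // m IH.
by rewrite addSn visitsS (leq_trans IH) ?leq_addr.
Qed.

Lemma visitsE (p : peer_id) s : visits p s = s %/ k.+1 + (p < s %% k.+1).
Proof.
elim: s => [|s IH]; first by rewrite /visits big_ord0 div0n mod0n ltn0.
rewrite visitsS IH -val_eqE /=.
have pk := ltn_ord p; have := divn_eq s k.+1; have := ltn_pmod s (ltn0Sn k).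
have := divn_eq s.+1 k.+1; have := ltn_pmod s.+1 (ltn0Sn k).
nia.
Qed.

(** Full turns pass all peers equally often, and the incomplete last turn adds at most one. *)
Lemma visits_balanced p q s : visits p s <= (visits q s).+1.
Proof. rewrite !visitsE; lia. Qed.

Lemma neq_peers {p q : peer_id} : p != q -> 0 < k.
Proof. by have := ltn_ord p; have := ltn_ord q; rewrite -val_eqE /=; lia. Qed.

(** * One round against a fixed adversary *)

Hypothesis f_lt_k : f <= k.
(* For a single peer and n = 1 the messages have width w = 0, but none is sent. *)
Hypothesis message_fits : 0 < k -> k.+1.*2 <= 2 ^ w.
Variables (X : n.-tuple bool) (adv : adversary k.+1).
Hypothesis few_faults : #|faulty adv| <= f.
Local Notation C := (run rotating X adv).
Local Notation Q := (queries_made rotating X adv).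
Local Notation F := (faulty adv).

(** The state of p is current at the start of round t, even if p crashes during that round;
    [alive t.+1 p] unfolds to [survives adv t p]. *)
Definition alive (t : nat) (p : peer_id) : bool :=
  if adv p is Some c then t <= crash_round c else true.

Lemma alive_le {t t' p} : t <= t' -> alive t' p -> alive t p.
Proof. by rewrite /alive; case: (adv p) => // c; apply: leq_trans. Qed.

Lemma may_send_alive {t p q} : may_send adv t p q -> alive t p.
Proof.
rewrite /may_send /alive; case: (adv p) => // c /orP[/ltnW //|/andP[/eqP->]] //.
Qed.

Lemma nonfaultyE {p} : p \notin F -> adv p = None.
Proof. by rewrite inE; case: (adv p). Qed.

Lemma nonfaulty_alive t {p} : p \notin F -> alive t p.
Proof. by rewrite /alive => /nonfaultyE->. Qed.

(* [h p] is the claim of [p] after [j] rounds of a phase about the bit [b] that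
   starts at [s].  In the first case no nonfaulty peer has been coordinator in
   this phase; in the second the live peers have reached agreement. *)
Definition phase_state t j s b (h : peer_id -> option (bool * nat)) :=
  [/\ forall x, x < j -> inZp (s + x) \in F,
      forall p, alive t p -> h p = None \/ exists2 e, e < j & h p = Some (b, e)
    & forall p, p \notin F -> Q t p <= visits p s] \/
  exists d,
  [/\ d < j, forall x, x < d -> inZp (s + x) \in F,
      forall p, alive t p -> h p = Some (b, d)
    & forall p, p \notin F -> Q t p <= visits p (s + d).+1].

Definition agreement t i j s h :=
  forall p, alive t p -> C t p = Peer p (take i X) s j (h p).

Lemma queries_madeS t p : Q t.+1 p = Q t p + #|queried (C t p)|.
Proof. exact: big_ord_recr. Qed.

Lemma card_needed s :
  #|needed s| <= ((self s == coordinator s) && (held s == None)).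
Proof.
rewrite /needed; have [_|off] := boolP (_ && _).
  apply/card_le1_eqP => i j; rewrite !inE => /and3P[_ _ /eqP si].
  move=> /and3P[_ _ /eqP sj]; by apply: val_inj; rewrite si sj.
rewrite leqn0 cards_eq0; apply/eqP/setP => i.
by rewrite !inE andbA (negPf off).
Qed.

(** A faulty coordinator may reach only some peers, which leaves correct bits with differing
    offsets. The first nonfaulty one reaches all live peers and so creates agreement; later
    coordinators only repeat the common claim. *)
Lemma round_step {t i j s h} : i < n -> j <= f ->
  agreement t i j s h -> phase_state t j s (nth false X i) h ->
  exists2 h',
    forall p, alive t.+1 p ->
      C t.+1 p = end_phase (Peer p (take i X) s j.+1 (h' p))
  & phase_state t.+1 j.+1 s (nth false X i) h'.
Proof.
move=> i_n j_f agr ph.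
have szi : size (take i X) = i by rewrite size_take size_tuple i_n.
have live p : alive t p -> halted (C t p) = false.
  by move=> al; rewrite /halted (agr p al) /= insubF // szi ltn_eqF.
pose c : peer_id := inZp (s + j).
(* The claim that c broadcasts if it is live: the one it holds, or else a fresh one with its own
   offset j. *)
pose v := odflt (nth false X i, j) (h c).
have claimE : alive t c -> claim (C t c) (answer X (C t c)) = v.
  move=> al; rewrite {1}(agr c al) /claim /v /=; case hc: (h c) => [//|] /=.
  congr pair; rewrite szi insubT /= ffunE /queried live // (agr c al) inE /=.
  by rewrite /coordinator /= eqxx hc eqxx szi eqxx /= (tnth_nth false).
pose h' p :=
  learn (C t p) (answer X (C t p)) [ffun q => sent X adv t (C t) q p].
exists h'.
  move=> p al1; have al : alive t p by apply: alive_le al1.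
  rewrite /= /step live //=.
  have -> : survives adv t p by [].
  by rewrite /= /advance -/(h' p) {1 2 3 4}(agr p al).
have v2 : alive t c -> v.2 <= j /\ v.1 = nth false X i.
  move=> al; rewrite /v; case: ph => [[_ hc _]|[d [dj _ hc _]]].
    by case: (hc c al) => [->|[e ej ->]] //=; rewrite ltnW.
  by rewrite (hc c al) /= ltnW.
have coordE p : alive t p -> coordinator (C t p) = c by move=> al; rewrite agr.
have selfE p : alive t p -> self (C t p) = p by move=> al; rewrite agr.
have h'_heard p : alive t.+1 p -> c = p \/ may_send adv t c p ->
    alive t c /\ h' p = Some v.
  move=> al1 hyp; have al : alive t p by apply: alive_le al1.
  have alc : alive t c by case: hyp => [->//|/may_send_alive].
  split=> //; rewrite /h' /learn coordE // selfE //; case: eqP => [->|/eqP pc].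
    by rewrite claimE.
  case: hyp => [E|ms]; first by rewrite E eqxx in pc.
  rewrite ffunE /sent live // ms eq_sym pc /= /broadcast coordE // selfE //.
  rewrite eqxx claimE // encodeK //.
  apply: leq_trans (message_fits (neq_peers pc)).
  by rewrite leq_double ltnS (leq_trans (v2 alc).1) // (leq_trans j_f).
have h'_unheard p : alive t.+1 p -> c != p -> ~~ may_send adv t c p ->
    h' p = h p.
  move=> al1 cp nms; have al : alive t p by apply: alive_le al1.
  rewrite /h' /learn coordE // selfE // eq_sym (negPf cp) ffunE /sent.
  by rewrite (negPf nms) !andbF agr.
have h'E p : alive t.+1 p -> h' p = h p \/ alive t c /\ h' p = Some v.
  move=> al; have [E|cp] := eqVneq c p.
    by right; apply: h'_heard al _; left.
  case ms: (may_send adv t c p); first by right; apply: h'_heard al _; right.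
  by left; apply: h'_unheard; rewrite ?ms.
have Qle p : p \notin F -> Q t.+1 p <= Q t p + ((p == c) && (h c == None)).
  move=> pF; have al := nonfaulty_alive t pF.
  rewrite queries_madeS leq_add2l /queried live //=.
  apply: leq_trans (card_needed _) _; rewrite selfE // coordE //.
  by case: eqP => //= <-; rewrite agr.
case: ph => [[sF hF QF]|[d [dj dF hF QF]]]; last first.
  right; exists d; split=> //; first exact: leqW.
  - move=> p al; case: (h'E p al) => [->|[alc ->]].
      by apply: hF; apply: alive_le al.
    by rewrite /v hF.
  - move=> p pF; apply: leq_trans (Qle p pF) _.
    case: eqP => [E|_]; last by rewrite addn0 QF.
    by rewrite -E hF ?nonfaulty_alive // addn0 QF.
have [cF|cF] := boolP (c \in F).
  left; split.
  - by move=> x; rewrite ltnS leq_eqVlt => /orP[/eqP->|/sF].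
  - move=> p al; case: (h'E p al) => [->|[alc ->]].
      case: (hF p (alive_le (leqnSn t) al)) => [->|[e ej ->]]; [by left|right].
      by exists e => //; apply: leqW.
    right; exists v.2; first exact: (v2 alc).1.
    by rewrite -(v2 alc).2 -surjective_pairing.
  - move=> p pF; apply: leq_trans (Qle p pF) _.
    by case: eqP => [E|_]; [rewrite E cF in pF|rewrite addn0 QF].
have alc := nonfaulty_alive t cF; have [vj v1] := v2 alc.
right; exists v.2; split=> //.
- by move=> x xv; apply: sF; apply: leq_trans vj.
- move=> p al; rewrite -v1 -surjective_pairing; apply: (h'_heard p al _).2.
  by right; rewrite /may_send nonfaultyE.
- move=> p pF; apply: leq_trans (Qle p pF) _.
  case: eqP => [E|_] /=; last first.
    by rewrite addn0 (leq_trans (QF p pF)) // visits_mono // leqW ?leq_addr.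
  (* If c had to query, then the agreed offset is j, and the new starting point lies just past c:
     this visit pays for the query. *)
  rewrite /v; case: eqP => [->|_] /=; last first.
    by rewrite addn0 (leq_trans (QF p pF)) // visits_mono // leqW ?leq_addr.
  rewrite visitsS -/c E eqxx leq_add2r -E (leq_trans (QF p pF)) //.
  exact: visits_mono (leq_addr _ _).
Qed.

(** * Amortization over phases *)

(** As f < k + 1, these f + 1 consecutive peers are distinct, too many to be all faulty. *)
Lemma nonfaulty_coordinator s : ~ (forall x, x < f.+1 -> inZp (s + x) \in F).
Proof.
move=> allF; pose g (x : 'I_f.+1) : peer_id := inZp (s + x).
have g_inj : injective g.
  move=> x y /(congr1 val) /= /eqP; rewrite eqn_modDl => /eqP.
  rewrite !modn_small; first exact: val_inj.
    by have := ltn_ord y; lia.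
  by have := ltn_ord x; lia.
have : #|g @: [set: 'I_f.+1]| <= #|F|.
  by apply/subset_leq_card/subsetP => _ /imsetP[x _ ->]; apply: allF.
by rewrite card_imset // cardsT card_ord leqNgt ltnS few_faults.
Qed.

(** Peers skipped before the one named in the agreed claim are faulty, so a phase adds at most the
    single visit of [sum_visitsS]. *)
Lemma sum_visits s d : (forall x, x < d -> inZp (s + x) \in F) ->
  \sum_(p in ~: F) visits p (s + d) = \sum_(p in ~: F) visits p s.
Proof.
elim: d => [|d IH] dF; first by rewrite addn0.
rewrite -IH => [|x xd]; last by apply: dF; apply: leqW.
apply: eq_bigr => p; rewrite inE addnS visitsS => pF.
by case: eqP => [E|_]; [rewrite -E dF in pF | rewrite addn0].
Qed.

Lemma sum_visitsS s :
  \sum_(p in ~: F) visits p s.+1 <= (\sum_(p in ~: F) visits p s).+1.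
Proof.
under eq_bigr do rewrite visitsS.
rewrite big_split /= -[leqRHS]addn1 leq_add2l.
have <- : \sum_p (inZp s == p :> peer_id) = 1.
  by rewrite (bigD1 (inZp s)) //= eqxx big1 // => p; rewrite eq_sym => /negPf->.
by rewrite [leqRHS](bigID (mem (~: F))) leq_addr.
Qed.

Definition invariant t i j s h :=
  [/\ agreement t i j s h, \sum_(p in ~: F) visits p s <= i
    & phase_state t j s (nth false X i) h].

Lemma invariant_holds {t} : t <= n * f.+1 ->
  exists i j s h, [/\ t = i * f.+1 + j, j <= f & invariant t i j s h].
Proof.
elim: t => [_|t IH t_n].
  exists 0, 0, 0, (fun=> None); split=> //; split.
  - by move=> p _; rewrite take0.
  - by rewrite big1 // => p _; rewrite /visits big_ord0.
  - left; split=> // [p _|p _]; first by left.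
    by rewrite /queries_made big_ord0.
have [i [j [s [h [tE j_f [agr vis ph]]]]]] := IH (ltnW t_n).
have i_n : i < n by rewrite -(ltn_pmul2r (ltn0Sn f)); lia.
have [h' stepE ph'] := round_step i_n j_f agr ph.
have [j_lt|] := boolP (j.+1 <= f).
  exists i, j.+1, s, h'; split=> //; first by rewrite tE addnS.
  split=> // p al; by rewrite stepE // /end_phase /= j_lt.
rewrite -leqNgt => f_j; have jE : j = f by apply/eqP; rewrite eqn_leq j_f.
(* At the end of a phase, f + 1 faulty coordinators are impossible, so agreement has been
   reached. *)
subst j; case: ph' => [[allF _ _]|[d [dj dF hF QF]]].
  by case: (nonfaulty_coordinator s).
exists i.+1, 0, (s + d).+1, (fun=> None); split=> //.
  by rewrite tE mulSn; lia.
split.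
- move=> p al; rewrite stepE // /end_phase /= ltnn hF //=.
  by rewrite -take_nth ?size_tuple.
- by apply: leq_trans (sum_visitsS _) _; rewrite sum_visits.
- by left; split=> // p _; left.
Qed.

(** * Bounds for the whole execution *)

Lemma invariant_final : exists s h, invariant (n * f.+1) n 0 s h.
Proof.
have [i [j [s [h [tE j_f inv]]]]] := invariant_holds (leqnn _).
have iE : i = n by apply/eqP; rewrite eqn_leq; nia.
have jE : j = 0 by move: tE; rewrite iE; lia.
by subst i j; exists s, h.
Qed.

Lemma rotating_downloaded : downloaded rotating X adv (n * f.+1).
Proof.
have [s [h [agr _ _]]] := invariant_final.
move=> p pF; rewrite (agr p (nonfaulty_alive _ pF)) /=.
by rewrite take_oversize ?size_tuple ?valK.
Qed.

(** By balance every nonfaulty peer is visited at least [(visits p s).-1] times, while all these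
    visits together number at most n. *)
Lemma rotating_queries {p} : p \notin F ->
  Q (n * f.+1) p * (k.+1 - f) <= n + (k.+1 - f).
Proof.
move=> pF; have [s [h [_ vis ph]]] := invariant_final.
have Qp : Q (n * f.+1) p <= visits p s by case: ph => [[_ _ ->]|[d []]].
have k_F : k.+1 - f <= #|~: F|.
  by rewrite cardsCs setCK card_ord leq_sub2l.
have : \sum_(q in ~: F) (visits p s).-1 <= n.
  apply: leq_trans vis; apply: leq_sum => q _.
  have := visits_balanced p q s; lia.
rewrite sum_nat_const; nia.
Qed.

Lemma leq_messages_sent t : messages_sent rotating X adv t <= t * k.+1 ^ 2.
Proof.
rewrite -[X in _ <= X * _](card_ord t) -sum_nat_const; apply: leq_sum => r _.
apply: leq_trans (_ : \sum_(p in ~: F) k.+1 <= _).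
  by apply: leq_sum => p _; rewrite -[leqRHS](card_ord k.+1) max_card.
by rewrite sum_nat_const leq_mul // -[leqRHS](card_ord k.+1) max_card.
Qed.

End RotatingCoordinator.

(** * Constants of the asymptotic bounds *)

Arguments rotating_queries {k n f w} _ _ X {adv} _ {p}.

(* One constant c serves for all the O-bounds, including the message size.
   The factor f is read as max(f, 1), so that f = 0 is covered: with f = 0 the
   literal bounds would allow no round at all. *)
Theorem theorem5p9 (R : realFieldType) :
  exists c : nat,
  forall (beta gamma : R) (k n f : nat),
    0 <= beta -> beta < 1 -> gamma = 1 - beta ->
    (0 < k)%N -> (k <= n)%N -> f%:R <= beta * k%:R ->
  exists P : protocol k n (c * trunc_log 2 n)%N,
  forall (X : n.-tuple bool) (adv : adversary k),
    (#|faulty adv| <= f)%N ->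
  exists T : nat,
    [/\ downloaded P X adv T,
        forall p : 'I_k, p \notin faulty adv ->
          (queries_made P X adv T p)%:R <= c%:R * (n%:R / (gamma * k%:R)),
        (T <= c * (n * maxn f 1))%N
      & (messages_sent P X adv T <= c * (k ^ 2 * maxn f 1 * n))%N].
Proof.
(* The 3 comes from the message width: with l the logarithm, 2(k + 1) is at most 2^(l + 2), and l +
   2 is at most 3l once l is positive. The other bounds hold with factor 2. *)
exists 3 => beta gamma [//|k] n f beta0 beta1 -> _ k_n f_k.
have f_lt : (f <= k)%N.
  rewrite -ltnS -(ltr_nat R); apply: le_lt_trans f_k _.
  by rewrite -[ltRHS]mul1r ltr_pM2r ?ltr0Sn.
have fits : (0 < k)%N -> (k.+1.*2 <= 2 ^ (3 * trunc_log 2 n))%N.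
  move=> k0; have n2 : (1 < n)%N by apply: leq_trans k_n.
  have : (0 < trunc_log 2 n)%N by rewrite trunc_log_gt0.
  have := trunc_log_ltn n (isT : (1 < 2)%N).
  set l := trunc_log 2 n => n_l l0.
  apply: leq_trans (_ : 2 ^ l.+2 <= _)%N; last by rewrite leq_exp2l //; lia.
  by rewrite -mul2n expnS leq_mul2l /=; apply: leq_trans (ltnW n_l).
exists (rotating k n f (3 * trunc_log 2 n)) => X adv few; exists (n * f.+1)%N.
have rounds : (n * f.+1 <= 2 * (n * maxn f 1))%N by nia.
split.
- exact: rotating_downloaded.
- move=> p pF; have := rotating_queries f_lt fits X few pF.
  set q := queries_made _ _ _ _ _ => Hq.
  have gk : 0 < (1 - beta) * k.+1%:R by rewrite mulr_gt0 ?subr_gt0 ?ltr0Sn.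
  rewrite mulrA ler_pdivlMr //.
  (* The bound on f gives (1 - beta)(k + 1) at most k + 1 - f. *)
  apply: le_trans (_ : q%:R * (k.+1 - f)%:R <= _).
    rewrite ler_wpM2l // natrB ?mulrBl ?mul1r ?lerB //; exact: leqW.
  rewrite -!natrM ler_nat; apply: leq_trans Hq _; lia.
- lia.
- apply: leq_trans (leq_messages_sent _ _ _ _ _ _ _) _.
  apply: leq_trans (leq_mul rounds (leqnn _)) _; lia.
Qed.
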